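(* Let $\zeta$ be a real algebraic number with $2(\zeta-1)>L(\zeta)$. Then $\zeta$ is a Pisot number. In other words, if $P\in\mathbb{Z}[X]$ has a real root larger than $L(P)/2+1$, then all the other roots of $P$ lie inside the unit circle.
   Context: For a polynomial $P(X)=a_0+a_1X+\cdots+a_mX^m$ let $L(P):=\sum_{i=0}^m |a_i|$. For an algebraic number $\zeta$, $L(\zeta):=L(P)$ where $P\in\mathbb{Z}[X]$ is the minimal polynomial of $\zeta$ over $\mathbb{Z}$ in lowest terms (coefficients with greatest common divisor $1$). A Pisot number is a real algebraic integer greater than $1$ all of whose other conjugates lie strictly inside the unit circle in $\mathbb{C}$. *)

(* Defs.v *)
From HB Require Import structures.
From mathcomp Require Import all_boot all_order all_algebra all_field.
Set Implicit Arguments. Unset Strict Implicit. Unset Printing Implicit Defensive.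
Import Order.TTheory GRing.Theory Num.Theory.
Local Open Scope ring_scope.

Definition polyL (R : numDomainType) (P : {poly R}) : R :=
  \sum_(i < size P) `|P`_i|.

(* [minCpoly z] is the monic minimal polynomial over the rationals, viewed in
   {poly algC}; [minCpolyP] gives its rational preimage, [rat_poly_scale]
   clears denominators, and [zprimitive] divides by the content and makes the
   leading coefficient positive. *)
Definition minZpoly (z : algC) : {poly int} :=
  zprimitive (tag (rat_poly_scale (s2val (minCpolyP z)))).

Definition algL (z : algC) : int := polyL (minZpoly z).

(* The conjugates of [z] are the roots of [minCpoly z]. *)
Definition Pisot (z : algC) : Prop :=
  [/\ z \in Aint, z \is Num.real, 1 < z &
      forall w : algC, root (minCpoly z) w -> w != z -> `|w| < 1].

Lemma minZpoly_neq0 (z : algC) : minZpoly z != 0.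
Proof.
rewrite /minZpoly; case: rat_poly_scale => q [a _] /= Dp.
rewrite zprimitive_eq0; apply: contra_eq_neq Dp => ->.
rewrite raddf0 scaler0; case: (minCpolyP z) => p [/= Dz mon_p] _.
exact: monic_neq0.
Qed.

Lemma zcontents_minZpoly (z : algC) : zcontents (minZpoly z) = 1.
Proof. by rewrite zcontents_primitive -zprimitive_eq0 minZpoly_neq0. Qed.

Lemma map_minZpoly (z : algC) :
  map_poly intr (minZpoly z) = (lead_coef (minZpoly z))%:~R *: minCpoly z.
Proof.
have nz := minZpoly_neq0 z; move: nz; rewrite /minZpoly.
case: rat_poly_scale => q [a nz_a] /=; case: (minCpolyP z) => p [/= -> mon_p] _.
move=> Dp; set r := zprimitive q => nz_r.
have [b nz_b Dr] : exists2 b : rat, b != 0 & map_poly intr r = b *: p.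
  have nz_c : (zcontents q)%:~R != 0 :> rat.
    by rewrite intr_eq0 zcontents_eq0 -zprimitive_eq0.
  have nz_a' : a%:~R != 0 :> rat by rewrite intr_eq0.
  exists ((zcontents q)%:~R^-1 * a%:~R); first by rewrite mulf_neq0 ?invr_neq0.
  have Dq : map_poly intr q = (zcontents q)%:~R *: map_poly intr r :> {poly rat}.
    by rewrite -map_polyZ /= -zpolyEprim.
  by rewrite Dp scalerA mulfK // Dq scalerA mulVf ?scale1r.
have Db : b = (lead_coef r)%:~R.
  have := congr1 lead_coef Dr; rewrite lead_coefZ (monicP mon_p) mulr1 => <-.
  by rewrite lead_coef_map_inj //; apply: intr_inj.
have := congr1 (map_poly (ratr : rat -> algC)) Dr.
rewrite map_polyZ Db /= ratr_int => <-.
by rewrite -[RHS]map_poly_comp; apply: eq_map_poly => x /=; rewrite ratr_int.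
Qed.

(* Main.v *)
(** If [P = (X - x) Q], then [x Q = X Q - P] gives [|x| L(Q) <= L(Q) + L(P)].
    So [L(P) < 2 (x - 1)] forces [L(Q) < 2].  As [Q] has the nonzero integer
    leading coefficient [a] of [P], this means that [|a| = 1] and that the other
    coefficients of [Q] have total size less than [|a|], so that the leading term
    dominates outside the open unit disk. *)
Require Import Defs.
From HB Require Import structures.
From mathcomp Require Import all_boot all_order all_algebra all_field.
Set Implicit Arguments. Unset Strict Implicit. Unset Printing Implicit Defensive.
Import Order.TTheory GRing.Theory Num.Theory.
Local Open Scope ring_scope.

Section PolyLength.
Variable R : numDomainType.
Implicit Types (p q : {poly R}) (x w : R).

(** Padding with zero coefficients lets polynomials of different sizes be summed over one index
    range. *)
Lemma polyL_widen n p : (size p <= n)%N -> polyL p = \sum_(i < n) `|p`_i|.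
Proof.
move=> le_pn; rewrite /polyL (big_ord_widen _ (fun i => `|p`_i|) le_pn).
rewrite big_mkcond /=; apply: eq_bigr => i _.
by case: ltnP => // /(nth_default 0) ->; rewrite normr0.
Qed.

Lemma polyL_ge0 p : 0 <= polyL p.
Proof. exact: sumr_ge0. Qed.

Lemma polyL_sub p q : polyL (p - q) <= polyL p + polyL q.
Proof.
set n := maxn (size p) (size q).
rewrite (@polyL_widen n (p - q)); last first.
  by apply: leq_trans (size_polyD _ _) _; rewrite size_polyN.
rewrite (@polyL_widen n p) ?leq_maxl // (@polyL_widen n q) ?leq_maxr //.
by rewrite -big_split ler_sum //= => i _; rewrite coefB ler_normB.
Qed.

Lemma polyLZ x p : polyL (x *: p) = `|x| * polyL p.
Proof.
rewrite (polyL_widen (size_scale_leq x p)) /polyL mulr_sumr.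
by apply: eq_bigr => i _; rewrite coefZ normrM.
Qed.

Lemma polyLMX p : polyL (p * 'X) = polyL p.
Proof.
have le_size : (size (p * 'X)%R <= (size p).+1)%N.
  by apply: leq_trans (size_polyMleq _ _) _; rewrite size_polyX addn2.
rewrite (polyL_widen le_size) big_ord_recl coefMX normr0 add0r.
by apply: eq_bigr => i _; rewrite coefMX.
Qed.

Lemma polyL_factor_le q x : (`|x| - 1) * polyL q <= polyL (q * ('X - x%:P)).
Proof.
rewrite mulrBl mul1r -polyLZ -(polyLMX q) lerBlDr.
have -> : x *: q = q * 'X - q * ('X - x%:P).
  by rewrite mulrBr opprB addrC subrK mulrC mul_polyC.
by rewrite [leRHS]addrC polyL_sub.
Qed.

Lemma norm_lead_coef_le_polyL p : `|lead_coef p| <= polyL p.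
Proof.
have [->|nz_p] := eqVneq p 0; first by rewrite lead_coef0 normr0 polyL_ge0.
rewrite lead_coefE /polyL; have : (0 < size p)%N by rewrite size_poly_gt0.
by case: (size p) => // n _; rewrite big_ord_recr lerDr sumr_ge0.
Qed.

(** At the root [w] the leading term is minus the sum of the others. Since [1 <= |w|], no lower
    power of [w] exceeds the top one in norm, so dividing by the top power bounds [|lead_coef p|] by
    the total size of the other coefficients. *)
Lemma root_ge1_polyL p w :
  root p w -> 1 <= `|w| -> `|lead_coef p| *+ 2 <= polyL p.
Proof.
have [-> _ _|nz_p] := eqVneq p 0.
  by rewrite lead_coef0 normr0 mul0rn polyL_ge0.
rewrite lead_coefE /polyL /root horner_coef.
have : (0 < size p)%N by rewrite size_poly_gt0.
case: (size p) => // n _; rewrite !big_ord_recr /= addrC addr_eq0 => /eqP Dw w1.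
rewrite mulr2n lerD2r.
(* If [p] is constant, having a root makes its only coefficient zero. *)
case: n Dw => [|n] Dw.
  by move: Dw; rewrite !big_ord0 oppr0 expr0 mulr1 => ->; rewrite normr0.
have w0 : 0 < `|w| by apply: lt_le_trans w1.
rewrite -(ler_pM2r (exprn_gt0 n.+1 w0)) -normrX -normrM Dw normrN.
apply: le_trans (ler_norm_sum _ _ _) _; rewrite mulr_suml ler_sum // => i _.
by rewrite normrM ler_wpM2l // !normrX ler_weXn2l // ltnW.
Qed.

End PolyLength.

Lemma polyL_map_intr (R : numDomainType) (P : {poly int}) :
  polyL (map_poly intr P : {poly R}) = (polyL P)%:~R.
Proof.
have le_size : (size (map_poly intr P : {poly R}) <= size P)%N.
  exact: size_poly.
rewrite (polyL_widen le_size) /polyL rmorph_sum.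
by apply: eq_bigr => i _; rewrite coef_map /= intr_norm.
Qed.

Lemma norm_int_ge1 (R : numDomainType) (a : int) : a != 0 -> 1 <= `|a%:~R| :> R.
Proof.
by move=> a0; rewrite -intr_norm -[1]/(1%:~R) ler_int -gtz0_ge1 normr_gt0.
Qed.

Section LargeRoot.
Variables (R : numDomainType) (P : {poly int}) (x : R).
Hypotheses (Px0 : root (map_poly intr P) x) (ltLx : (polyL P)%:~R < 2 * (x - 1)).

Lemma large_root_gt1 : 1 < x.
Proof.
have /le_lt_trans/(_ ltLx) : 0 <= (polyL P)%:~R :> R by rewrite ler0z polyL_ge0.
by rewrite pmulr_rgt0 ?ltr0n // subr_gt0.
Qed.

Lemma large_root_cofactor : exists2 q : {poly R},
  map_poly intr P = q * ('X - x%:P) & polyL q < 2.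
Proof.
have /factor_theorem[q Dq] := Px0; exists q => //.
have x1 := large_root_gt1; have x0 : 0 < x by apply: lt_trans x1.
have x10 : 0 < x - 1 by rewrite subr_gt0.
(* After multiplication by [x - 1 > 0] the goal reads [(x - 1) * polyL q < 2 * (x - 1)], and the
   length of [P] lies in between. *)
rewrite -(ltr_pM2l x10) [ltRHS]mulrC; apply: le_lt_trans ltLx.
by rewrite -polyL_map_intr Dq -{1}(gtr0_norm x0) polyL_factor_le.
Qed.

(** The cofactor only has coefficients in [R], but ['X - x%:P] is monic, so its leading coefficient
    is still an integer. *)
Lemma lead_coef_large_root_cofactor (q : {poly R}) :
  map_poly intr P = q * ('X - x%:P) -> lead_coef q = (lead_coef P)%:~R.
Proof.
move/(congr1 lead_coef).
by rewrite lead_coef_map_inj ?lead_coef_Mmonic ?monicXsubC //; apply: intr_inj.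
Qed.

(** A nonzero integer of norm at most [polyL q < 2] is a unit; this is what makes the large root an
    algebraic integer. *)
Lemma large_root_lead_coef : P != 0 -> `|lead_coef P| = 1.
Proof.
move=> nzP; have [q Dq q2] := large_root_cofactor.
have := le_lt_trans (norm_lead_coef_le_polyL q) q2.
rewrite (lead_coef_large_root_cofactor Dq) -intr_norm -[2]/(2%:~R) ltr_int.
have : 0 < `|lead_coef P| by rewrite normr_gt0 lead_coef_eq0.
by case: `|_| => [[|[|n]]|n].
Qed.

(** Such a [w] is a root of the cofactor [q]; if [1 <= |w|], then
    [2 <= 2 * |lead_coef q| <= polyL q < 2]. *)
Lemma large_root_others (w : R) : P != 0 ->
  root (map_poly intr P) w -> w != x -> `|w| < 1.
Proof.
move=> nzP; have [q Dq q2] := large_root_cofactor.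
rewrite Dq rootM root_XsubC => /orP[qw0 _|/eqP->]; last by rewrite eqxx.
(* The order on [R] is partial; [|w|] and 1 are comparable because both are real. *)
rewrite real_ltNge ?realE ?normr_ge0 ?ler01 //.
apply/negP => /(root_ge1_polyL qw0) /le_lt_trans/(_ q2).
rewrite (lead_coef_large_root_cofactor Dq) ltr_pMn2r //.
by apply/negP; rewrite -real_leNgt ?norm_int_ge1 ?lead_coef_eq0 ?realE ?normr_ge0 ?ler01.
Qed.

End LargeRoot.

Theorem theorem2p1 :
  (forall z : algC, z \is Num.real ->
     2 * (z - 1) > (algL z)%:~R -> Pisot z)
  /\
  (forall (P : {poly int}) (x : algC),
     P != 0 -> x \is Num.real -> root (map_poly intr P) x ->
     x > (polyL P)%:~R / 2 + 1 ->
     forall w : algC, root (map_poly intr P) w -> w != x -> `|w| < 1).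
Proof.
have others (P : {poly int}) (x w : algC) : P != 0 ->
    root (map_poly intr P) x -> (polyL P)%:~R < 2 * (x - 1) ->
    root (map_poly intr P) w -> w != x -> `|w| < 1.
  by move=> nzP Px0 ltLx; apply: large_root_others Px0 ltLx w nzP.
split=> [z Rz ltLz | P x nzP _ Px0 ltLx w]; last first.
  by apply: others; rewrite // mulrC -ltr_pdivrMr ?ltr0n // ltrBrDr.
have nzP := minZpoly_neq0 z; have DP := map_minZpoly z.
have nza : (lead_coef (minZpoly z))%:~R != 0 :> algC.
  by rewrite intr_eq0 lead_coef_eq0.
(* The two minimal polynomials are proportional, so the conjugates of [z] are the roots of
   either. *)
have rootP w : root (map_poly intr (minZpoly z)) w = root (minCpoly z) w.
  by rewrite DP rootZ.
have Pz0 : root (map_poly intr (minZpoly z)) z by rewrite rootP root_minCpoly.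
split=> //; first last.
- by move=> w; rewrite -rootP; apply: others.
- exact: large_root_gt1 ltLz.
have a1 := large_root_lead_coef Pz0 ltLz nzP.
apply: (root_monic_Aint (root_minCpoly z) (minCpoly_monic z)).
(* With [a] the leading coefficient of [minZpoly z], the latter is [a *: minCpoly z]; multiplying by
   [a] once more gives the factor [a ^+ 2 = 1], whichever the sign of [a]. Hence [minCpoly z] has
   integer coefficients. *)
have -> : minCpoly z = map_poly intr (lead_coef (minZpoly z) *: minZpoly z).
  rewrite map_polyZ DP scalerA -intrM -expr2 -real_normK ?num_real // a1 expr1n.
  by rewrite scale1r.
by apply/polyOverP => i; rewrite coef_map intr_int.
Qed.
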